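(* If $A\in\mathbb R_+^{m\times n}$ is a nonnegative matrix, then $$\tau_+(A)\ge\chi_{\mathrm{frac}}(\mathrm{RG}(A))\qquad\text{and}\qquad \tau_+^{\mathrm{sos}}(A)\ge\bar\vartheta(\mathrm{RG}(A)).$$
   Context: $\mathbb R_+^{m\times n}$ is the set of entrywise nonnegative real $m\times n$ matrices; $\le$ between matrices is entrywise. For $A\in\mathbb R_+^{m\times n}$ define $$\mathcal A_+(A)=\{R\in\mathbb R^{m\times n}: \operatorname{rank}R\le 1,\ 0\le R\le A\},$$ $$\tau_+(A)=\max\{L(A): L \text{ a linear functional on }\mathbb R^{m\times n},\ L(R)\le 1\ \ \forall R\in\mathcal A_+(A)\}.$$ $\operatorname{vec}(A)\in\mathbb R^{mn}$ is the vector obtained by stacking the columns of $A$; coordinates of $\mathbb R^{mn}$, and rows and columns of a real symmetric $mn\times mn$ matrix $X$, are indexed by pairs $ij$ with $1\le i\le m$, $1\le j\le n$ (so that $\operatorname{vec}(A)_{ij}=A_{ij}$). The quantity $\tau_+^{\mathrm{sos}}(A)$ is the optimal value of the semidefinite program: minimize $t$ over $t\in\mathbb R$ and real symmetric $mn\times mn$ matrices $X$ subject to $$\begin{bmatrix}t&\operatorname{vec}(A)^T\\ \operatorname{vec}(A)&X\end{bmatrix}\succeq 0,\qquad X_{ij,ij}\le A_{ij}^2\ \ \forall i,j,\qquad X_{ij,kl}=X_{il,kj}\ \ \text{for all } 1\le i<k\le m,\ 1\le j<l\le n.$$ The rectangle graph $\mathrm{RG}(A)$ is the undirected graph whose vertices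 are the index pairs $(i,j)$ with $A_{i,j}>0$, with an edge between $(i,j)$ and $(k,l)$ if and only if $A_{i,l}A_{k,j}=0$. $\chi_{\mathrm{frac}}(\mathrm{RG}(A))$ is the fractional chromatic number of $\mathrm{RG}(A)$, equivalently the fractional rectangle cover number of $A$: letting $\mathcal A_B(A)$ be the set of matrices $R\in\{0,1\}^{m\times n}$ that are indicators of monochromatic rectangles for $A$ (i.e. of sets $I\times J$ with $A_{i,j}>0$ for all $(i,j)\in I\times J$), it is the minimum of $\sum_{R\in\mathcal A_B(A)}x_R$ over $x_R\ge 0$ subject to $\sum_{R\in\mathcal A_B(A)}x_RR_{i,j}\ge 1$ for every $(i,j)$ with $A_{i,j}>0$. For a graph $G=(V,E)$, the complement Lovász theta number $\bar\vartheta(G)$ (the Lovász theta number of the complement of $G$) is the minimum of $t$ over $t\in\mathbb R$ and real symmetric matrices $X$ indexed by $V$ subject to $\begin{bmatrix}t&\mathbf 1^T\\ \mathbf 1&X\end{bmatrix}\succeq 0$, $X_{u,u}=1$ for all $u\in V$, and $X_{u,v}=0$ for all $\{u,v\}\in E$, where $\mathbf 1$ is the all-ones vector. *)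

(* Defs.v *)
From HB Require Import structures.
From mathcomp Require Import all_boot all_order all_algebra.
From mathcomp Require Import all_classical all_reals ereal.

Set Implicit Arguments.
Unset Strict Implicit.
Unset Printing Implicit Defensive.

Import Order.TTheory GRing.Theory Num.Theory.
Local Open Scope classical_set_scope.
Local Open Scope ring_scope.

(* All optimal values are taken in the extended reals, as suprema or infima of
   the set of objective values at feasible points; thus no default value ever
   stands in for the optimum of an infeasible or unbounded program. *)

Section Semidefinite.
Variable R : realType.

Definition psdmx N (M : 'M[R]_N) : Prop :=
  M \is symmetricmx /\ forall x : 'cV[R]_N, 0 <= (x^T *m M *m x) 0 0.

Definition bordered N (t : R) (v : 'cV[R]_N) (X : 'M[R]_N) : 'M[R]_(1 + N) :=
  block_mx t%:M v^T v X.

End Semidefinite.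

Record sgraph := SGraph {
  vertex : finType;
  edge : rel vertex;
  edge_sym : symmetric edge;
  edge_irr : irreflexive edge }.

Section GraphParameters.
Variables (R : realType) (G : sgraph).

Definition stable (S : {set vertex G}) : bool :=
  [forall u in S, forall v in S, ~~ edge u v].

Definition fractional_coloring (x : {set vertex G} -> R) : Prop :=
  (forall S, stable S -> 0 <= x S) /\
  (forall v, 1 <= \sum_(S : {set vertex G} | stable S && (v \in S)) x S).

Definition frac_chromatic : \bar R :=
  ereal_inf [set (\sum_(S : {set vertex G} | stable S) x S)%:E
            | x in fractional_coloring].

(* Matrices indexed by the vertices are indexed by their ranks in the
   enumeration of the vertex type. *)
Definition theta_bar_feasible (t : R) (X : 'M[R]_#|vertex G|) : Prop :=
  [/\ X \is symmetricmx,
      psdmx (bordered t (const_mx 1) X),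
      forall u : vertex G, X (enum_rank u) (enum_rank u) = 1 &
      forall u v : vertex G, edge u v -> X (enum_rank u) (enum_rank v) = 0].

Definition theta_bar : \bar R :=
  ereal_inf [set t%:E | t in [set t | exists X, theta_bar_feasible t X]].

End GraphParameters.

Section NonnegativeMatrix.
Variables (R : realType) (m n : nat) (A : 'M[R]_(m, n)).

Definition rank1_below : set 'M[R]_(m, n) :=
  [set B | (\rank B <= 1)%N /\ forall i j, 0 <= B i j <= A i j].

Definition tau_plus : \bar R :=
  ereal_sup [set (L A)%:E
            | L in [set L : {scalar 'M[R]_(m, n)} |
                     forall B, rank1_below B -> L B <= 1]].

(* mxvec is row-major, so stacking the columns of A is mxvec applied to A^T,
   and the coordinate of index ij is mxvec_index j i. *)
Definition colvec : 'cV[R]_(n * m) := (mxvec A^T)^T.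

Definition pair_index (i : 'I_m) (j : 'I_n) : 'I_(n * m) := mxvec_index j i.

Lemma colvecE i j : colvec (pair_index i j) 0 = A i j.
Proof. by rewrite mxE mxvecE mxE. Qed.

Definition tau_plus_sos_feasible (t : R) (X : 'M[R]_(n * m)) : Prop :=
  [/\ X \is symmetricmx,
      psdmx (bordered t colvec X),
      forall i j, X (pair_index i j) (pair_index i j) <= A i j ^+ 2 &
      forall (i k : 'I_m) (j l : 'I_n), (i < k)%N -> (j < l)%N ->
        X (pair_index i j) (pair_index k l) =
        X (pair_index i l) (pair_index k j)].

Definition tau_plus_sos : \bar R :=
  ereal_inf [set t%:E | t in [set t | exists X, tau_plus_sos_feasible t X]].

Definition supp : finType := {p : 'I_m * 'I_n | 0 < A p.1 p.2}.

Definition rg_edge (u v : supp) : bool :=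
  A (val u).1 (val v).2 * A (val v).1 (val u).2 == 0.

Lemma rg_edge_sym : symmetric rg_edge.
Proof. by move=> u v; rewrite /rg_edge mulrC. Qed.

Lemma rg_edge_irr : irreflexive rg_edge.
Proof.
by move=> u; apply: negbTE; rewrite mulf_neq0 // gt_eqF //; exact: (valP u).
Qed.

Definition RG : sgraph := SGraph rg_edge_sym rg_edge_irr.

(* The 0/1 indicator matrices are boolean, which makes them a finite type. *)
Definition mono_rect (B : 'M[bool]_(m, n)) : bool :=
  [exists I : {set 'I_m}, exists J : {set 'I_n},
     (B == \matrix_(i, j) ((i \in I) && (j \in J))) &&
     [forall i in I, forall j in J, 0 < A i j]].

Definition fractional_cover (x : 'M[bool]_(m, n) -> R) : Prop :=
  (forall B, mono_rect B -> 0 <= x B) /\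
  (forall i j, 0 < A i j ->
     1 <= \sum_(B : 'M[bool]_(m, n) | mono_rect B) x B * (B i j)%:R).

Definition frac_rect_cover : \bar R :=
  ereal_inf [set (\sum_(B : 'M[bool]_(m, n) | mono_rect B) x B)%:E
            | x in fractional_cover].

End NonnegativeMatrix.

Section RectangleCover.
Variables (R : realType) (m n : nat) (A : 'M[R]_(m, n)).
Hypothesis A0 : forall i j, 0 <= A i j.

Let rect_stable (B : 'M[bool]_(m, n)) : {set vertex (RG A)} :=
  [set u : supp A | B (val u).1 (val u).2].

Let stable_rect (S : {set vertex (RG A)}) : 'M[bool]_(m, n) :=
  \matrix_(i, j) ((i \in [set (val (u : supp A)).1 | u in S]%SET) &&
                  (j \in [set (val (u : supp A)).2 | u in S]%SET)).

Let rect_stableP B : mono_rect A B -> stable (rect_stable B).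
Proof.
case/existsP=> I /existsP[J /andP[/eqP-> /forall_inP AIJ]].
apply/forall_inP=> u; rewrite inE mxE => /andP[uI uJ].
apply/forall_inP=> v; rewrite inE mxE => /andP[vI vJ].
by rewrite /= /rg_edge mulf_neq0 // gt_eqF //;
  [have/forall_inP := AIJ _ uI | have/forall_inP := AIJ _ vI]; exact.
Qed.

Let stable_rectP S : stable S -> mono_rect A (stable_rect S).
Proof.
move=> /forall_inP st; apply/existsP; eexists; apply/existsP; eexists.
apply/andP; split; first exact/eqP.
apply/forall_inP=> _ /imsetP[u uS ->]; apply/forall_inP=> _ /imsetP[v vS ->].
have /forall_inP/(_ v vS) := st u uS; rewrite /= /rg_edge mulf_eq0 negb_or.
by rewrite lt_neqAle A0 andbT eq_sym => /andP[].
Qed.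

Lemma frac_chromatic_RG : frac_chromatic R (RG A) = frac_rect_cover A.
Proof.
apply/eqP; rewrite eq_le; apply/andP; split.
- apply: le_ereal_inf => _ [x [x0 xc] <-].
  pose y (S : {set vertex (RG A)}) := \sum_(B | mono_rect A B && (rect_stable B == S)) x B.
  exists y; first split.
  + by move=> S _; apply: sumr_ge0 => B /andP[/x0].
  + move=> v; have := xc _ _ (valP v); move/le_trans; apply.
    rewrite (eq_bigr (fun B : 'M[bool]_(m, n) => if B (val v).1 (val v).2 then x B else 0));
      last by move=> B _; case: ifP; rewrite ?mulr1 ?mulr0.
    rewrite -big_mkcondr /=.
    rewrite (partition_big rect_stable
      (fun S => stable S && (v \in S))) /=; last first.
      by move=> B /andP[/rect_stableP-> Bv]; rewrite inE.
    apply: ler_sum => S /andP[_ vS].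
    rewrite le_eqVlt; apply/orP; left; apply/eqP/eq_bigl => B.
    case: eqP => [BS|]; rewrite ?andbF ?andbT //.
    by move: vS; rewrite -BS inE => ->; rewrite andbT.
  + by congr (_%:E); rewrite (partition_big rect_stable (@stable (RG A))).
- apply: le_ereal_inf => _ [x [x0 xc] <-].
  pose y (B : 'M[bool]_(m, n)) := \sum_(S | stable S && (stable_rect S == B)) x S.
  exists y; first split.
  + by move=> B _; apply: sumr_ge0 => S /andP[/x0].
  + move=> i j Aij; pose v : vertex (RG A) := exist _ (i, j) Aij : supp A.
    apply: (le_trans (xc v)).
    rewrite (partition_big stable_rect (mono_rect A)) /=; last first.
      by move=> S /andP[/stable_rectP].
    apply: ler_sum => B _; rewrite /y mulr_suml.
    rewrite big_mkcond [leRHS]big_mkcond; apply: ler_sum => S _ /=.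
    have [sS|] := boolP (@stable (RG A) S) => /=; last by [].
    have [SB|_] := eqVneq; last by rewrite andbF.
    have [vS|_] := boolP (v \in S) => /=; last by rewrite mulr_ge0 ?ler0n ?x0.
    rewrite -SB mxE (_ : i \in _); last by apply/imsetP; exists v.
    by rewrite (_ : j \in _) ?mulr1 //; apply/imsetP; exists v.
  + by congr (_%:E); rewrite (partition_big stable_rect (mono_rect A)).
Qed.

End RectangleCover.

(* Main.v *)
From HB Require Import structures.
Require Import Defs.
From mathcomp Require Import all_boot all_order all_algebra.
From mathcomp Require Import all_classical all_reals ereal.
From mathcomp Require Import ring.

Set Implicit Arguments.
Unset Strict Implicit.
Unset Printing Implicit Defensive.

Import Order.TTheory GRing.Theory Num.Theory.

Local Open Scope ring_scope.

(* By LP duality, the fractional chromatic number is the largest total weight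
   of a vertex weighting [y] with weight at most 1 on every stable set.  The
   functional [B |-> sum_v y_v B_v / A_v] has value [sum_v y_v] at [A] and is at
   most 1 on [rank1_below A], because the support of a nonnegative rank-one
   matrix below [A] is a rectangle inside the support of [A], that is, a stable
   set of the rectangle graph.
   For the semidefinite bound, rescale a feasible [X] by [1 / (A_u A_v)] on the
   support and raise the diagonal to 1; edges of the rectangle graph get a zero
   entry because a vanishing diagonal entry of a positive semidefinite matrix
   kills its whole row. *)

(** * Farkas' lemma over a real field *)

(* Bartl's induction: if a violating [x0] exists once the first column [a] is
   dropped, normalise [x0 *m a = 1] and project along [x0] onto [ker a]. *)
Lemma farkas (F : realFieldType) (d k : nat) (M : 'M[F]_(d, k)) (c : 'cV[F]_d) :
  (forall x : 'rV_d, (forall j, (x *m M) 0 j <= 0) -> (x *m c) 0 0 <= 0) ->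
  exists2 l : 'cV[F]_k, forall j, 0 <= l j 0 & M *m l = c.
Proof.
elim: k M c => [|k IHk]; last rewrite -[k.+1]/(1 + k)%N; move=> M c Mc.
  exists 0 => [[]//|]; rewrite mulmx0; apply/esym/colP => i; rewrite mxE.
  have xc (x : 'rV_d) : (x *m c) 0 0 <= 0 by apply: Mc => -[].
  apply/eqP; rewrite eq_le; apply/andP; split.
    by have := xc (delta_mx 0 i); rewrite -rowE mxE.
  by have := xc (- delta_mx 0 i); rewrite mulNmx -rowE !mxE oppr_le0.
rewrite -[M]hsubmxK in Mc *.
move: (lsubmx _) (rsubmx _) Mc => a {}M Mc.
have [|] := pselect (forall x : 'rV_d, (forall j, (x *m M) 0 j <= 0) ->
  (x *m c) 0 0 <= 0).
  move=> /IHk[l l0 Ml]; exists (col_mx 0 l).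
    by move=> j; rewrite mxE; case: splitP => j' _; rewrite ?mxE.
  by rewrite mul_row_col mulmx0 add0r.
move=> /existsNP[x /not_implyP[xM /negP]]; rewrite -ltNge => xc.
have xa : 0 < (x *m a) 0 0.
  rewrite ltNge; apply/negP => xa; move: xc; rewrite ltNge Mc // => j.
  rewrite mul_mx_row mxE; case: splitP => j' _ //.
  by rewrite (ord1 j').
pose x0 := ((x *m a) 0 0)^-1 *: x.
have x0a : x0 *m a = 1%:M.
  by rewrite [LHS]mx11_scalar -scalemxAl mxE mulVf ?gt_eqF.
have x0M j : (x0 *m M) 0 j <= 0.
  by rewrite -scalemxAl mxE; apply: mulr_ge0_le0; rewrite ?invr_ge0 ?(ltW xa).
have x0c : 0 < (x0 *m c) 0 0.
  by rewrite -scalemxAl mxE mulr_gt0 ?invr_gt0.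
pose P := 1%:M - a *m x0.
have Pa : P *m a = 0 by rewrite mulmxBl mul1mx -mulmxA x0a mulmx1 subrr.
(* Each [y *m P] annihilates [a], so [Mc] applies to it with the constraint of the first column met
   trivially. *)
have [y yPM|l l0 PMl] := IHk (P *m M) (P *m c).
  rewrite mulmxA; apply: Mc => j; rewrite mul_mx_row mxE.
  case: splitP => j' _; last by rewrite -mulmxA.
  by rewrite -mulmxA Pa mulmx0 mxE.
(* Expanding [P], [PMl] says that [c - M *m l] equals [a *m x0 *m (c - M *m l)], which dictates the
   multiplier of [a]. It is nonnegative since [x0c] is positive and [x0 *m M] has no positive
   entry. *)
exists (col_mx (x0 *m (c - M *m l)) l).
  move=> j; rewrite mxE; case: splitP => j' _ //.
  rewrite (ord1 j') mulmxBr mxE [X in _ + X]mxE subr_ge0.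
  apply: le_trans (ltW x0c); rewrite mulmxA mxE.
  by apply: sumr_le0 => i _; rewrite mulr_le0_ge0.
rewrite mul_row_col mulmxA mulmxBr.
move: PMl; rewrite -mulmxA !mulmxBl !mul1mx => /eqP.
rewrite subr_eq => /eqP Ml.
by rewrite [X in _ + X]Ml addrCA addrNK addrNK.
Qed.

Lemma farkas_fin (F : realFieldType) (I J : finType) (a : I -> J -> F)
    (c : J -> F) :
  (forall x : J -> F, (forall i, \sum_j x j * a i j <= 0) ->
     \sum_j x j * c j <= 0) ->
  exists2 l : I -> F, forall i, 0 <= l i & forall j, \sum_i a i j * l i = c j.
Proof.
move=> ac.
pose M := \matrix_(j < #|J|, i < #|I|) a (enum_val i) (enum_val j).
have [x xM|l l0 Ml] := @farkas F _ _ M (\col_j c (enum_val j)).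
  rewrite mxE (reindex (@enum_rank J)) /=; last exact/onW_bij/enum_rank_bij.
  under eq_bigr do rewrite mxE enum_rankK.
  apply: (ac (fun j => x 0 (enum_rank j))) => i.
  have := xM (enum_rank i).
  rewrite mxE (reindex (@enum_rank J)) /=; last exact/onW_bij/enum_rank_bij.
  by under eq_bigr do rewrite mxE !enum_rankK.
exists (fun i => l (enum_rank i) 0) => // j.
have := congr1 (fun v : 'cV_#|J| => v (enum_rank j) 0) Ml.
rewrite !mxE enum_rankK => <-.
rewrite [RHS](reindex (@enum_rank I)) /=; last exact/onW_bij/enum_rank_bij.
by apply: eq_bigr => i _; rewrite mxE !enum_rankK.
Qed.

(** * Linear programming duality for the fractional chromatic number *)

Section FractionalChromatic.
Variables (R : realType) (G : sgraph).

Definition fractional_clique (y : vertex G -> R) : Prop :=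
  (forall v, 0 <= y v) /\ (forall S, stable S -> \sum_(v in S) y v <= 1).

Lemma stable0 : stable (finset.set0 : {set vertex G}).
Proof. by apply/forall_inP => u; rewrite inE. Qed.

Lemma stable1 (v : vertex G) : stable [set v]%SET.
Proof.
apply/forall_inP => u /set1P ->; apply/forall_inP => w /set1P ->.
by rewrite edge_irr.
Qed.

(* The coordinate [None] is the homogenising variable [s]: Farkas' lemma is
   applied to the implication
   [y >= 0 -> (sum_S y <= s for all stable S) -> sum y <= t * s]. *)
Lemma frac_chromatic_le (t : R) :
  (forall y, fractional_clique y -> \sum_v y v <= t) ->
  (frac_chromatic R G <= t%:E)%E.
Proof.
move=> yt.
(* Row [inl C] encodes the constraint of a stable set [C] and is zero for other sets; row [inr u]
   encodes [0 <= y u]. *)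
pose a (i : {set vertex G} + vertex G) (j : option (vertex G)) : R :=
  match i, j with
  | inl C, Some v => (stable C && (v \in C))%:R
  | inl C, None => - (stable C)%:R
  | inr u, Some v => - (u == v)%:R
  | inr _, None => 0
  end.
pose c (j : option (vertex G)) : R := if j is Some _ then 1 else - t.
have sum_option (f : option (vertex G) -> R) :
    \sum_j f j = f None + \sum_v f (Some v).
  rewrite (bigD1 None) //=; congr (_ + _).
  rewrite (reindex_omap Some id) /=; last by case.
  by apply: eq_bigl => v; rewrite eqxx.
have [x xa|l l0 al] := @farkas_fin R _ _ a c.
- have x0 v : 0 <= x (Some v).
    have := xa (inr v); rewrite sum_option /= mulr0 add0r (bigD1 v) //= eqxx.
    rewrite mulrN1 big1 ?addr0 ?oppr_le0 // => u uv.
    by rewrite eq_sym (negbTE uv) oppr0 mulr0.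
  have xS S : stable S -> \sum_(v in S) x (Some v) <= x None.
    move=> sS; have := xa (inl S); rewrite sum_option /= sS mulrN1 addrC subr_le0.
    by under eq_bigr do rewrite mulr_natr mulrb; rewrite -big_mkcond.
  have s0 : 0 <= x None by have := xS _ stable0; rewrite big_set0.
  rewrite sum_option /= mulrN addrC subr_le0; under eq_bigr do rewrite mulr1.
  (* If [s = 0], the stable singletons force all weights to vanish; otherwise dividing by [s] gives
     a fractional clique. *)
  have [s0'|s_neq0] := eqVneq (x None) 0.
    rewrite s0' mul0r big1 // => v _; apply/eqP; rewrite eq_le x0 andbT.
    by have := xS _ (stable1 v); rewrite big_set1 s0'.
  have s_gt0 : 0 < x None by rewrite lt_neqAle eq_sym s_neq0.
  rewrite -ler_pdivrMl // mulr_sumr; apply: yt; split=> [v|S sS].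
    by rewrite mulr_ge0 ?invr_ge0.
  by rewrite -mulr_sumr ler_pdivrMl // mulr1 xS.
- have sum_sum (f : {set vertex G} + vertex G -> R) :
      \sum_i f i = \sum_S f (inl S) + \sum_v f (inr v) by exact: big_sumType.
  (* The multipliers of the stable sets form the colouring: column [Some v] gives coverage 1 plus
     the slack [l (inr v)], column [None] gives total weight [t]. *)
  apply: ereal_inf_lbound; exists (fun S => l (inl S)); first split => //.
    move=> v; have := al (Some v); rewrite sum_sum /= => <-.
    rewrite [leRHS]big_mkcond -[leRHS]addr0; apply: lerD; last first.
      by apply: sumr_le0 => u _; rewrite mulNr oppr_le0 mulr_ge0.
    by apply: ler_sum => S _; case: (_ && _); rewrite ?mul1r ?mul0r.
  have := al None; rewrite sum_sum /= [X in _ + X]big1; last first.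
    by move=> v _; rewrite mul0r.
  rewrite addr0 => /(congr1 -%R); rewrite opprK -sumrN => <-.
  congr (_%:E); rewrite big_mkcond; apply: eq_bigr => S _.
  by case: (stable S); rewrite ?mulN1r ?opprK ?oppr0 ?mul0r ?oppr0.
Qed.

End FractionalChromatic.

(** * The bound on [tau_plus] *)

Section RectangleGraphBounds.
Variables (R : realType) (m n : nat) (A : 'M[R]_(m, n)).

(** By the rank factorisation, the entries of [B] are products [u i * v j], or all zero in rank
    0. *)
Lemma rank_le1_minor (F : fieldType) (B : 'M[F]_(m, n)) i j k l :
  (\rank B <= 1)%N -> B i l * B k j = B i j * B k l.
Proof.
rewrite -{2 3 4 5}[B]mulmx_base; move: (col_base B) (row_base B).
case: (\rank B) => [|[|//]] u v _; first by rewrite !mxE !big_ord0 !mul0r.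
by rewrite !mxE !big_ord1; ring.
Qed.

Definition weighted_sum (y : supp A -> R) (B : 'M[R]_(m, n)) : R :=
  \sum_v y v / A (val v).1 (val v).2 * B (val v).1 (val v).2.

Lemma weighted_sum_is_scalar y : scalar (weighted_sum y).
Proof.
move=> a B C; rewrite /weighted_sum mulr_sumr -big_split.
by apply: eq_bigr => v _ /=; rewrite !mxE mulrDr mulrCA.
Qed.

HB.instance Definition _ y :=
  GRing.isLinear.Build R 'M[R]_(m, n) R *%R (weighted_sum y)
    (weighted_sum_is_scalar y).

(** For two positive entries of [B], the vanishing 2 by 2 minor makes the opposite corners of [B]
    nonzero; an edge would put a zero of [A], hence of [B], at one of them. *)
Lemma stable_rank1_supp (B : 'M[R]_(m, n)) : rank1_below A B ->
  @stable (RG A) [set v : supp A | 0 < B (val v).1 (val v).2].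
Proof.
move=> [rkB B_A]; apply/forall_inP => u; rewrite inE => Bu.
apply/forall_inP => v; rewrite inE => Bv /=.
have: B (val u).1 (val v).2 * B (val v).1 (val u).2 != 0.
  by rewrite (rank_le1_minor _ (val u).2) // mulf_neq0 // gt_eqF.
rewrite /rg_edge; apply: contraNneq => /eqP; rewrite mulf_eq0 => /orP[] /eqP A0.
  have := B_A (val u).1 (val v).2; rewrite A0 => /le_anti <-.
  by rewrite mul0r.
have := B_A (val v).1 (val u).2; rewrite A0 => /le_anti <-.
by rewrite mulr0.
Qed.

Lemma clique_le_tau_plus (y : supp A -> R) : fractional_clique (G := RG A) y ->
  ((\sum_v y v)%:E <= tau_plus A)%E.
Proof.
move=> [y0 yS]; apply: ereal_sup_ubound; exists (weighted_sum y) => [B AB|].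
  apply: le_trans (yS _ (stable_rank1_supp AB)).
  rewrite [leRHS]big_mkcond /weighted_sum; apply: ler_sum => v _; rewrite inE.
  have /andP[B0 BA] := AB.2 (val v).1 (val v).2; have A0 := valP v.
  case: ifPn => [_|]; last first.
    by rewrite -leNgt => B0'; rewrite mulr_ge0_le0 // divr_ge0 // ltW.
  by rewrite -mulrA ler_piMr // ler_pdivrMl // mulr1.
congr (_%:E); apply: eq_bigr => v _.
by rewrite divfK // gt_eqF // (valP v).
Qed.

Lemma frac_chromatic_RG_le_tau_plus :
  (frac_chromatic R (RG A) <= tau_plus A)%E.
Proof.
have := clique_le_tau_plus; case: (tau_plus A) => [t||] ctau.
- by apply: frac_chromatic_le => y /ctau; rewrite lee_fin.
- exact: leey.
(* The zero clique gives [0 <= tau_plus A], which excludes the value [-oo]. *)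
- have /ctau : fractional_clique (G := RG A) (fun=> 0 : R).
    by split=> // S _; rewrite big1 ?ler01.
  by rewrite big1.
Qed.

End RectangleGraphBounds.

(** * Positive semidefinite matrices *)

Section PositiveSemidefinite.
Variable R : realType.

Lemma symmetricmxP N (M : 'M[R]_N) : M \is symmetricmx <-> M^T = M.
Proof.
rewrite is_hermitianmxE expr0 scale1r map_mx_id //.
by split=> [/eqP<- //|->].
Qed.

Lemma psdmxD N (M M' : 'M[R]_N) : psdmx M -> psdmx M' -> psdmx (M + M').
Proof.
move=> [/symmetricmxP symM M0] [/symmetricmxP symM' M'0]; split.
  by apply/symmetricmxP; rewrite linearD /= symM symM'.
by move=> x; rewrite mulmxDr mulmxDl mxE addr_ge0.
Qed.

Lemma psdmx_congr N N' (M : 'M[R]_N) (Q : 'M[R]_(N, N')) :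
  psdmx M -> psdmx (Q^T *m M *m Q).
Proof.
move=> [/symmetricmxP symM M0]; split.
  by apply/symmetricmxP; rewrite !trmx_mul trmxK symM mulmxA.
move=> x; rewrite !mulmxA -trmx_mul -mulmxA; exact: M0.
Qed.

Lemma psdmx_diag N (d : 'rV[R]_N) : (forall i, 0 <= d 0 i) -> psdmx (diag_mx d).
Proof.
move=> d0; split; first by apply/symmetricmxP; rewrite tr_diag_mx.
move=> x; rewrite mxE; apply: sumr_ge0 => i _.
by rewrite mul_mx_diag !mxE mulrAC mulr_ge0 // -expr2 sqr_ge0.
Qed.

Lemma psdmx_bordered N (t : R) (v : 'cV[R]_N) (X : 'M[R]_N) :
  psdmx (bordered t v X) -> psdmx X.
Proof.
move=> /(psdmx_congr (col_mx 0 1%:M)).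
rewrite tr_col_mx trmx0 trmx1 mul_row_block !mul0mx !mul1mx !add0r.
by rewrite mul_row_col mulmx0 mulmx1 add0r.
Qed.

(* With [M p p = 0] the form at [a e_p + e_q] is [2 a M_pq + M_qq], affine in [a]. *)
Lemma psdmx_diag0 N (M : 'M[R]_N) p q : psdmx M -> M p p <= 0 -> M p q = 0.
Proof.
move=> [/symmetricmxP symM M0] Mpp; apply/eqP; apply: contraT => Mpq.
have form_delta i j : ((delta_mx i 0 : 'cV_N)^T *m M *m (delta_mx j 0 : 'cV_N)) 0 0 = M i j.
  by rewrite trmx_delta -rowE -colE !mxE.
have Mqp : M q p = M p q by rewrite -[in LHS]symM mxE.
have /eqP Mpp0 : M p p == 0 by rewrite eq_le Mpp -form_delta M0.
(* This choice gives the form the value -1. *)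
pose a := - (M q q + 1) / (2 * M p q).
have := M0 (a *: delta_mx p 0 + delta_mx q 0).
rewrite [(_ + _)^T]linearD /= [(_ *: _)^T]linearZ /= !mulmxDl !mulmxDr -!scalemxAl -!scalemxAr.
have addE (B C : 'M[R]_1) : (B + C) 0 0 = B 0 0 + C 0 0 by rewrite mxE.
have scaleE b (B : 'M[R]_1) : (b *: B) 0 0 = b * B 0 0 by rewrite mxE.
rewrite !(addE, scaleE) !form_delta Mpp0 Mqp.
rewrite (_ : _ + _ = -1) ?ler0N1 //.
by rewrite /a; field.
Qed.

End PositiveSemidefinite.

(** * The bound on [tau_plus_sos] *)

Section ThetaBound.
Variables (R : realType) (m n : nat) (A : 'M[R]_(m, n)).

Definition supp_index (u : supp A) : 'I_(n * m) :=
  pair_index (val u).1 (val u).2.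

Definition supp_entry (u : supp A) : R := A (val u).1 (val u).2.

(** Restriction to the support and division by the entries of [A] become one congruence, which
    preserves semidefiniteness. *)
Definition supp_rescale : 'M[R]_(n * m, #|vertex (RG A)|) :=
  \matrix_(p, a) ((p == supp_index (enum_val a))%:R
                  / supp_entry (enum_val a)).

Lemma supp_entry_gt0 u : 0 < supp_entry u.
Proof. exact: (valP u). Qed.

Lemma mul_supp_rescale k (M : 'M[R]_(k, n * m)) i u :
  (M *m supp_rescale) i (enum_rank u) = M i (supp_index u) / supp_entry u.
Proof.
rewrite mxE (bigD1 (supp_index u)) //= mxE enum_rankK eqxx mul1r.
rewrite big1 ?addr0 // => p pu; rewrite mxE enum_rankK (negbTE pu).
by rewrite mul0r mulr0.
Qed.

Lemma supp_rescaleE (X : 'M[R]_(n * m)) u v :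
  (supp_rescale^T *m X *m supp_rescale) (enum_rank u) (enum_rank v) =
  X (supp_index u) (supp_index v) / (supp_entry u * supp_entry v).
Proof.
rewrite mul_supp_rescale -[X in _^T *m X]trmxK -trmx_mul mxE.
by rewrite mul_supp_rescale mxE -mulrA invfM.
Qed.

Lemma colvec_rescale : supp_rescale^T *m colvec A = const_mx 1.
Proof.
apply/colP => a; rewrite -[a]enum_valK -[colvec A]trmxK -trmx_mul mxE.
rewrite mul_supp_rescale mxE colvecE mxE divff // gt_eqF //.
exact: supp_entry_gt0.
Qed.

Lemma tau_plus_sos_edge t X u v : tau_plus_sos_feasible A t X ->
  rg_edge u v -> X (supp_index u) (supp_index v) = 0.
Proof.
move=> [/symmetricmxP symX psdX diagX minorX] uv.
have row0 i j q : A i j = 0 -> X (pair_index i j) q = 0.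
  move=> Aij; apply: psdmx_diag0 (psdmx_bordered psdX) _.
  by apply: le_trans (diagX i j) _; rewrite Aij expr0n.
have X_sym p q : X p q = X q p by rewrite -[in LHS]symX mxE.
move: uv; rewrite /rg_edge /supp_index.
case: u v => -[i j] /= Aij [[k l] /= Akl] /=.
rewrite mulf_eq0 => Ail_Akj.
have minor0 : X (pair_index i l) (pair_index k j) = 0.
  by case/orP: Ail_Akj => /eqP A0; [|rewrite X_sym]; apply: row0.
(* The minor constraint carries [minor0] to the wanted entry. It is stated for [i < k] and [j < l],
   and symmetry of [X] gives the other orders; if [i = k] or [j = l], then [A i l] and [A k j] are
   the positive entries at [u] and [v], so there is no edge. *)
have [ik|ki|/ord_inj ik] := ltngtP i k; last first.
- by move: Ail_Akj; rewrite ik (gt_eqF Akl) -ik (gt_eqF Aij).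
- have [jl|lj|/ord_inj jl] := ltngtP j l; last first.
  + by move: Ail_Akj; rewrite -jl (gt_eqF Aij) jl (gt_eqF Akl).
  + by rewrite X_sym minorX // X_sym.
  + by rewrite X_sym -minorX // X_sym.
- have [jl|lj|/ord_inj jl] := ltngtP j l; last first.
  + by move: Ail_Akj; rewrite -jl (gt_eqF Aij) jl (gt_eqF Akl).
  + by rewrite -minorX.
  + by rewrite minorX.
Qed.

Lemma theta_bar_RG_feasible t X : tau_plus_sos_feasible A t X ->
  exists Y, @theta_bar_feasible R (RG A) t Y.
Proof.
move=> tX; have [_ psdX diagX _] := tX.
pose Z := supp_rescale^T *m X *m supp_rescale.
pose d := \row_a (1 - Z a a).
have psdY : psdmx (bordered t (const_mx 1) (Z + diag_mx d)).
  (* Keeping the corner [t] fixed, the congruence turns the border [colvec A] into the all-ones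
     vector. The diagonal correction is nonnegative because [diagX] bounds the diagonal of [Z] by
     1. *)
  have -> : bordered t (const_mx 1) (Z + diag_mx d) =
      (block_mx 1%:M 0 0 supp_rescale)^T *m bordered t (colvec A) X
        *m block_mx 1%:M 0 0 supp_rescale + diag_mx (row_mx 0 d).
    rewrite /bordered diag_mx_row tr_block_mx !mulmx_block trmx1 !trmx0.
    rewrite !(mul0mx, mulmx0, mul1mx, mulmx1, addr0, add0r) add_block_mx.
    rewrite !(addr0, add0r) colvec_rescale -colvec_rescale trmx_mul trmxK.
    by rewrite trmxK linear0 addr0.
  apply: psdmxD; first exact: psdmx_congr.
  apply: psdmx_diag => a; rewrite mxE; case: splitP => [b _|b _].
    by rewrite mxE.
  rewrite mxE subr_ge0 -[b]enum_valK supp_rescaleE.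
  have A0 := supp_entry_gt0 (enum_val b).
  by rewrite ler_pdivrMr ?mulr_gt0 // mul1r -expr2 diagX.
exists (Z + diag_mx d); split=> //.
- by have [] := psdmx_bordered psdY.
- by move=> u; rewrite !mxE eqxx mulr1n addrCA subrr addr0.
move=> u v uv; rewrite mxE supp_rescaleE (tau_plus_sos_edge tX uv) mul0r add0r.
rewrite mxE (inj_eq enum_rank_inj) [u == v](_ : _ = false) //.
by apply: contraTF uv => /eqP ->; rewrite edge_irr.
Qed.

Lemma theta_bar_RG_le_tau_plus_sos :
  (theta_bar R (RG A) <= tau_plus_sos A)%E.
Proof.
by apply: ereal_inf_le_tmp => _ [t [X /theta_bar_RG_feasible tY] <-]; exists t.
Qed.

End ThetaBound.

Theorem theorem4 (R : realType) (m n : nat) (A : 'M[R]_(m, n))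
    (A_ge0 : forall i j, 0 <= A i j) :
  (tau_plus A >= frac_chromatic R (RG A))%E /\
  (tau_plus_sos A >= theta_bar R (RG A))%E.
Proof.
split; first exact: frac_chromatic_RG_le_tau_plus.
exact: theta_bar_RG_le_tau_plus_sos.
Qed.
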